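(* Let $a\geq 2$ and $\ell\geq 1$ be integers and let $t$ be a real number with $0<t<1/2$. Then \[ \dim_H\bigl(\mathcal{L}(a)\cap[0,t)\bigr)\le \frac{\log\left(2\lceil a^{\ell}t\rceil\right)}{\log a^{\ell}}, \] where $\mathcal{L}(a)=\{\limsup_{n\to\infty}\|\xi a^n\| : \xi\in\mathbb{R}\}$. In particular, $\mathcal{L}(a)$ has Lebesgue measure zero.
   Context: $\|x\|$ denotes the distance from the real number $x$ to the nearest integer; $\lceil x\rceil$ is the least integer $\geq x$; $\dim_H$ denotes Hausdorff dimension. *)

(* Defs.v *)
From HB Require Import structures.
From mathcomp Require Import all_boot all_order all_algebra.
From mathcomp Require Import all_classical all_reals all_analysis.

Set Implicit Arguments.
Unset Strict Implicit.
Unset Printing Implicit Defensive.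

Import Order.TTheory GRing.Theory Num.Theory.
Import numFieldNormedType.Exports.

Local Open Scope classical_set_scope.
Local Open Scope ring_scope.

Definition dist_int (R : realType) (x : R) : R :=
  inf [set `|x - m%:~R| | m in [set: int]].

(* The sequence is bounded (its values lie in [0, 1/2]), so the real-valued
   limn_sup is the genuine limit superior. *)
Definition spectrum (R : realType) (a : nat) : set R :=
  [set limn_sup (fun n : nat => dist_int (xi * a%:R ^+ n)) | xi in [set: R]].

Arguments spectrum R a : clear implicits.

(* 0 is adjoined so that the diameter of the empty set is 0 rather than -oo. *)
Definition ediam (R : realType) (U : set R) : \bar R :=
  ereal_sup (0%E |` [set z | exists x y, [/\ U x, U y & z = `|x - y|%:E]]).

(* At s = 0 every nonempty set has weight 1, since x `^ 0 = 1 also for x = 0. *)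
Definition hausdorff_weight (R : realType) (s : R) (U : set R) : \bar R :=
  if U == set0 then 0%E else (ediam U `^ s)%E.

Definition hausdorff_premeasure (R : realType) (s delta : R) (A : set R) :
    \bar R :=
  ereal_inf [set (\sum_(0 <= i <oo) hausdorff_weight s (U i))%E
            | U in [set U : (set R)^nat | A `<=` \bigcup_i U i /\
                                          forall i, (ediam (U i) <= delta%:E)%E]].

Definition hausdorff_measure (R : realType) (s : R) (A : set R) : \bar R :=
  ereal_sup [set hausdorff_premeasure s delta A | delta in [set d : R | 0 < d]].

Definition hausdorff_dim (R : realType) (A : set R) : \bar R :=
  ereal_inf [set s%:E | s in [set s : R | 0 <= s /\
                                          hausdorff_measure s A = 0%E]].

(* Main.v *)
Require Import Defs.
From HB Require Import structures.
From mathcomp Require Import all_boot all_order all_algebra.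
From mathcomp Require Import all_classical all_reals all_analysis.
From mathcomp Require Import zify ring lra.

Set Implicit Arguments.
Unset Strict Implicit.
Unset Printing Implicit Defensive.

Import Order.TTheory GRing.Theory Num.Theory.
Import numFieldNormedType.Exports.

Local Open Scope classical_set_scope.
Local Open Scope ring_scope.

(* An element alpha of the spectrum is, up to sign and an integer translation,
   a limit point of xi * a ^ n, so ||alpha a ^ k|| <= alpha for every k.  If
   alpha < t and b = a ^ l, every base-b digit of alpha is therefore among the
   first or the last ceil (b t) ones, so (2 ceil (b t)) ^ k intervals of length
   b ^ -k cover the spectrum below t.  For t < 1/2 and l large,
   2 ceil (b t) < b, and the total length of these covers tends to 0. *)

(** * One-sided characterisations of the limit superior of a bounded sequence *)

Section LimSup.
Context {R : realType}.
Implicit Types u : R^nat.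

(** Boundedness turns [limn_sup u] into the infimum of the tail suprema [sups u]; one of these lies
    below [l] and bounds its whole tail. *)
Lemma limn_sup_ltP u l : bounded_fun u -> limn_sup u < l ->
  exists N, forall n, (N <= n)%N -> u n < l.
Proof.
move=> bu; rewrite limn_supE// => /inf_lt[|_ [N _ <-] uNl].
  by exists (sups u 0%N); exists 0%N.
exists N => n Nn; apply: le_lt_trans uNl; apply: ub_le_sup.
  exact/has_ubound_sdrop/bounded_fun_has_ubound.
by exists n.
Qed.

Lemma lt_limn_supP u l : bounded_fun u -> l < limn_sup u ->
  forall N, exists2 n, (N <= n)%N & l < u n.
Proof.
move=> bu; rewrite limn_supE// => lu N.
have : l < sups u N.
  apply: (lt_le_trans lu); apply: ge_inf; last by exists N.
  exact: bounded_fun_has_lbound_sups.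
move=> /sup_gt[|_ [n /= Nn <-] ln]; first by exists (u N); exists N => /=.
by exists n.
Qed.

End LimSup.

(** * Distance to the nearest integer: size, Lipschitz bound, symmetry and periodicity *)

Section DistInt.
Context {R : realType}.
Implicit Types (x y z t : R) (m k : int).

Lemma dist_int_ge0 x : 0 <= dist_int x.
Proof. by apply: lb_le_inf => [|_ [m _ <-]//]; exists `|x - 0%:~R|; exists 0. Qed.

Lemma dist_int_le x m : dist_int x <= `|x - m%:~R|.
Proof. by apply: ge_inf; [exists 0 => _ [k _ <-]|exists m]. Qed.

(** This stands in for attainment of the infimum: below, an integer is always chosen with an
    arbitrarily small slack. *)
Lemma dist_int_ltP x t : dist_int x < t -> exists m, `|x - m%:~R| < t.
Proof.
move=> /inf_lt[|_ [m _ <-] xmt]; last by exists m.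
by exists `|x - 0%:~R|; exists 0.
Qed.

Lemma dist_int_half x : dist_int x <= 1 / 2.
Proof.
have /andP[fx xf] := floor_itv x; set m := Num.floor x in fx xf.
have [xm|mx] := leP (x - m%:~R) (1 / 2).
  by apply: le_trans (dist_int_le x m) _; rewrite ger0_norm//; lra.
apply: le_trans (dist_int_le x (m + 1)) _.
rewrite intrD in xf *; rewrite ltr0_norm; lra.
Qed.

Lemma dist_int_lip x y : dist_int x <= dist_int y + `|x - y|.
Proof.
apply/ler_addgt0Pr => e e0; have [|m ym] := @dist_int_ltP y (dist_int y + e).
  by rewrite ltrDl.
apply: le_trans (dist_int_le x m) _.
have := ler_distD y x m%:~R; lra.
Qed.

Lemma dist_intN x : dist_int (- x) = dist_int x.
Proof.
suff H z : dist_int (- z) <= dist_int z.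
  by apply/eqP; rewrite eq_le H -{1}(opprK x) H.
apply/ler_addgt0Pr => e e0.
have [|m zm] := @dist_int_ltP z (dist_int z + e).
  by rewrite ltrDl.
apply: le_trans (dist_int_le _ (- m)) _.
by rewrite intrN -opprD normrN; lra.
Qed.

Lemma dist_intB x m : dist_int (x - m%:~R) = dist_int x.
Proof.
suff H z k : dist_int (z - k%:~R) <= dist_int z.
  apply/eqP; rewrite eq_le H -{1}(subrK m%:~R x).
  by have := H (x - m%:~R) (- m); rewrite intrN opprK.
apply/ler_addgt0Pr => e e0.
have [|q zq] := @dist_int_ltP z (dist_int z + e).
  by rewrite ltrDl.
apply: le_trans (dist_int_le _ (q - k)) _.
rewrite intrB (_ : z - k%:~R - _ = z - q%:~R); last by ring.
lra.
Qed.

Lemma dist_int_normM x y : 0 <= y -> dist_int (`|x| * y) = dist_int (x * y).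
Proof. by case: (ger0P x) => // _ _; rewrite mulNr dist_intN. Qed.

End DistInt.

(** * Range of the spectrum and the orbit of its elements *)

Section Spectrum.
Context {R : realType} (a : nat).
Implicit Types alpha t : R.

Lemma bounded_dist_int_seq (u : R^nat) : bounded_fun (fun n => dist_int (u n)).
Proof.
exists 1; split=> // M M1 n _ /=; rewrite ger0_norm ?dist_int_ge0//.
by have := dist_int_half (u n); lra.
Qed.

Lemma spectrum_ge0 alpha : spectrum R a alpha -> 0 <= alpha.
Proof.
move=> [xi _ <-]; rewrite leNgt; apply/negP => /limn_sup_ltP.
move=> /(_ (bounded_dist_int_seq _))[N /(_ N (leqnn N))].
by rewrite ltNge dist_int_ge0.
Qed.

Lemma spectrum_le_half alpha : spectrum R a alpha -> alpha <= 1 / 2.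
Proof.
move=> [xi _ <-]; rewrite leNgt; apply/negP => /lt_limn_supP.
move=> /(_ (bounded_dist_int_seq _) 0%N)[n _].
by rewrite ltNge dist_int_half.
Qed.

(* Up to sign and translation by an integer, [alpha] is a limit point of the
   sequence [xi * a ^ n], so its orbit inherits the asymptotic bound [alpha]. *)
Lemma spectrum_orbit_le alpha : spectrum R a alpha ->
  forall k, dist_int (alpha * a%:R ^+ k) <= alpha.
Proof.
move=> [xi _ <-] k; set u := fun n => _; set l := limn_sup u.
have bu : bounded_fun u by exact: bounded_dist_int_seq.
set A : R := a%:R ^+ k; have A0 : 0 <= A by rewrite exprn_ge0.
(* The final error is [d] from the bound on [u (n + k)], plus [2 * d * A] from multiplying
   [|l - z| <= 2 * d] by [A]; this [d] makes the total equal to [e]. *)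
apply/ler_addgt0Pr => e e0; pose d := e / (1 + 2 * A).
have d0 : 0 < d by rewrite divr_gt0//; lra.
have -> : e = d + 2 * d * A by rewrite /d; field; lra.
have [N uN] := @limn_sup_ltP _ u (l + d) bu (ltac:(by rewrite ltrDl)).
have [n Nn un] := @lt_limn_supP _ u (l - d) bu (ltac:(by rewrite gtrBl)) N.
have [|m ym] := @dist_int_ltP _ (xi * a%:R ^+ n) (u n + d).
  by rewrite ltrDl.
have my : u n <= `|xi * a%:R ^+ n - m%:~R| by exact: dist_int_le.
have := uN _ Nn; set z := `|_ - _| in ym my => unl.
apply: le_trans (dist_int_lip _ (z * A)) _.
(* Up to sign, [z * A] is [xi * a ^ (n + k)] minus the integer [m * a ^ k]. *)
have -> : dist_int (z * A) = u (n + k)%N.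
  rewrite dist_int_normM// mulrBl -mulrA -exprD.
have -> : m%:~R * A = (m * (a%:Z ^+ k))%:~R.
    by rewrite intrM rmorphXn.
  by rewrite dist_intB.
have := uN (n + k)%N (leq_trans Nn (leq_addr _ _)).
rewrite -mulrBl normrM (ger0_norm A0).
have : `|l - z| * A <= 2 * d * A.
  by rewrite ler_wpM2r// ler_norml; apply/andP; split; lra.
lra.
Qed.

End Spectrum.

(** * Finite interval covers, Hausdorff measure and Lebesgue null sets *)

Section Covers.
Context {R : realType}.
Implicit Types (A : set R) (s w : R) (r : seq R).

(** The finite family is padded with empty sets because premeasures sum over sequences; the empty
    set has weight 0 for every exponent. *)
Definition itv_cover r w : (set R)^nat :=
  fun i => if (i < size r)%N then `[r`_i, r`_i + w]%classic else set0.

(** The set function [f] is kept general so that the bound serves both Hausdorff weights and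
    Lebesgue measure. *)
Lemma itv_cover_sum_le r w (f : set R -> \bar R) (c : R) :
  (forall U, (0 <= f U)%E) -> f set0 = 0%E ->
  (forall x, (f `[x, (x + w)%R]%classic <= c%:E)%E) ->
  (\sum_(0 <= i <oo) f (itv_cover r w i) <= ((size r)%:R * c)%:E)%E.
Proof.
move=> f0 fset0 fc; rewrite (nneseries_split 0 (size r))// add0n.
rewrite [X in (_ + X)%E]eseries0 ?adde0; last first.
  by move=> i ri _; rewrite /itv_cover ltnNge ri.
rewrite big_mkord.
apply: (@le_trans _ _ (\sum_(i < size r) c%:E)%E).
  by apply: lee_sum => i _; rewrite /itv_cover ltn_ord.
by rewrite sumEFin sumr_const card_ord mulr_natl.
Qed.

(** Finite covers by intervals of one common length [w], with left endpoints [r]. This common source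
    yields zero [s]-dimensional measure and, for [s = 1], Lebesgue negligibility. *)
Definition thin s A := forall e, 0 < e -> exists r w,
  [/\ 0 < w <= e, (size r)%:R * w `^ s <= e
    & A `<=` [set y | exists2 x, x \in r & x <= y <= x + w]].

Lemma sub_itv_cover A r w :
  A `<=` [set y | exists2 x, x \in r & x <= y <= x + w] ->
  A `<=` \bigcup_i itv_cover r w i.
Proof.
move=> Ar y /Ar[x xr xy]; exists (index x r) => //.
by rewrite /itv_cover index_mem xr nth_index//= in_itv.
Qed.

Lemma ediam_ge0 A : (0 <= ediam A)%E.
Proof. by apply: ereal_sup_ubound; left. Qed.

Lemma ediam_set0 : ediam (@set0 R) = 0%E.
Proof.
apply/eqP; rewrite eq_le ediam_ge0 andbT.
by apply: ge_ereal_sup => z [->//|[x [y []]]].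
Qed.

Lemma ediam_itv_le x w : 0 <= w -> (ediam `[x, (x + w)%R]%classic <= w%:E)%E.
Proof.
move=> w0; apply: ge_ereal_sup => u [->|[y [z [/= + + ->]]]].
  by rewrite lee_fin.
rewrite !in_itv/= => /andP[? ?] /andP[? ?].
by rewrite lee_fin ler_norml; apply/andP; split; lra.
Qed.

Lemma hausdorff_weight_ge0 s A : (0 <= hausdorff_weight s A)%E.
Proof. by rewrite /hausdorff_weight; case: ifP => // _; exact: poweR_ge0. Qed.

Lemma hausdorff_weight_itv_le s x w : 0 <= s -> 0 <= w ->
  (hausdorff_weight s `[x, (x + w)%R]%classic <= (w `^ s)%:E)%E.
Proof.
move=> s0 w0; rewrite /hausdorff_weight; case: ifP => _.
  by rewrite lee_fin powR_ge0.
rewrite -poweR_EFin gt0_ler_poweR// ?ediam_itv_le// in_itv/= ?ediam_ge0 ?leey//.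
by rewrite lee_fin w0.
Qed.

Lemma thin_hausdorff_measure s A : 0 <= s -> thin s A ->
  hausdorff_measure s A = 0%E.
Proof.
move=> s0 tA; apply/eqP; rewrite eq_le; apply/andP; split; last first.
  apply: (@le_trans _ _ (hausdorff_premeasure s 1 A)); last first.
    by apply: ereal_sup_ubound; exists 1 => //=.
  apply: le_ereal_inf_tmp => _ [U _ <-]. apply: nneseries_ge0 => i _ _.
  exact: hausdorff_weight_ge0.
apply: ge_ereal_sup => _ [d /= d0 <-]; apply/lee_addgt0Pr => e e0; rewrite add0e.
(* The minimum makes one cover satisfy both the diameter bound [d] and the sum bound [e]. *)
have [|r [w [/andP[w0 wde] rw Ar]]] := tA (Num.min d e).
  by rewrite lt_min d0.
move: wde rw; rewrite !le_min => /andP[wd _] /andP[_ rwe].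
apply: ge_ereal_inf.
exists (\sum_(0 <= i <oo) hausdorff_weight s (itv_cover r w i))%E => /=.
  exists (itv_cover r w) => //; split; first exact: sub_itv_cover.
  move=> i; rewrite /itv_cover; case: ifP => _.
    by rewrite (le_trans (ediam_itv_le _ (ltW w0)))// lee_fin.
  by rewrite ediam_set0 lee_fin ltW.
apply: (@le_trans _ _ ((size r)%:R * w `^ s)%:E); last by rewrite lee_fin.
apply: itv_cover_sum_le.
- exact: hausdorff_weight_ge0.
- by rewrite /hausdorff_weight eqxx.
- by move=> x; apply: hausdorff_weight_itv_le => //; exact: ltW.
Qed.

(** Negligibility asks for a single null measurable superset: intersect supersets of measure at most
    [1 / (n + 1)]. *)
Lemma negligible_small A :
  (forall e : R, 0 < e -> exists2 B, measurable B /\ A `<=` B &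
     ((@lebesgue_measure R) B <= e%:E)%E) ->
  (@lebesgue_measure R).-negligible A.
Proof.
move=> H; have inv0 n : 0 < n.+1%:R^-1 :> R by rewrite invr_gt0.
pose B n := sval (cid2 (H _ (inv0 n))).
have HB n : (measurable (B n) /\ A `<=` B n) /\
    ((@lebesgue_measure R) (B n) <= n.+1%:R^-1%:E)%E.
  by rewrite /B; case: cid2 => /= U ? ?; split.
have mB : measurable (\bigcap_n B n).
  by apply: bigcapT_measurable => n; have [[]] := HB n.
exists (\bigcap_n B n); split=> //; last first.
  by move=> x Ax n _; have [[_ +] _] := HB n; apply.
apply/eqP; rewrite eq_le measure_ge0 andbT.
apply/lee_addgt0Pr => e e0; rewrite add0e; near \oo => n.
apply: (@le_trans _ _ ((@lebesgue_measure R) (B n))).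
  apply: le_measure; rewrite ?inE//; last exact: bigcap_inf.
  by have [[]] := HB n.
have [_ /le_trans] := HB n; apply; rewrite lee_fin ltW//.
by near: n; exact: near_infty_natSinv_lt (PosNum e0).
Unshelve. all: by end_near. Qed.

Lemma thin_negligible A : thin 1 A -> (@lebesgue_measure R).-negligible A.
Proof.
move=> tA; apply: negligible_small => e /tA[r [w [/andP[w0 _] rw Ar]]].
have mU i : measurable (itv_cover r w i).
  by rewrite /itv_cover; case: ifP.
exists (\bigcup_i itv_cover r w i).
  split; [exact: bigcupT_measurable|exact: sub_itv_cover].
apply: (@le_trans _ _ (\sum_(0 <= i <oo) (@lebesgue_measure R) (itv_cover r w i))%E).
  by apply: generalized_Boole_inequality => //; exact: bigcupT_measurable.
rewrite powRr1 in rw; last exact: ltW.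
apply: (@le_trans _ _ ((size r)%:R * w)%:E); last by rewrite lee_fin.
apply: itv_cover_sum_le; [by move=> U; exact: measure_ge0|exact: measure0|].
move=> x; rewrite lebesgue_measure_itv/= lte_fin ltrDl w0 -EFinB lee_fin.
lra.
Qed.

End Covers.

(** * Base-[b] expansions with digits restricted to both ends of the range *)

Definition digits (b c : nat) : seq int :=
  [seq i%:Z | i <- iota 0 c] ++ [seq b%:Z - i.+1%:Z | i <- iota 0 c].

(** Numerators [m] of the intervals from [m / b ^ k] to [(m + 1) / b ^ k] whose [k] digits are all
    admissible. Repetitions are harmless, since only the length of the list is counted. *)
Fixpoint cells (b c k : nat) : seq int :=
  if k is k'.+1 then [seq b%:Z * m + d | m <- cells b c k', d <- digits b c]
  else [:: 0].

Lemma size_cells b c k : size (cells b c k) = ((2 * c) ^ k)%N.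
Proof.
elim: k => //= k IH; rewrite size_allpairs IH size_cat !size_map size_iota.
by rewrite addnn -mul2n expnSr.
Qed.

Lemma mem_digits (b c : nat) (d : int) :
  (0 <= d < c%:Z) || (b%:Z - c%:Z <= d < b%:Z) -> d \in digits b c.
Proof.
rewrite mem_cat => /orP[/andP[d0 dc]|/andP[bcd db]]; apply/orP; [left|right].
  by apply/mapP; exists `|d|%N; [rewrite mem_iota; lia|lia].
by apply/mapP; exists (`|b%:Z - d|.-1)%N; [rewrite mem_iota; lia|lia].
Qed.

Section Cells.
Context {R : realType} (b c : nat).
Implicit Types x y t : R.

(** Let [f] be the fractional part of [y]. An integer within [t] of [y] lies at or below the floor,
    so [f < t] and the digit is less than [c], or above it, so [1 - f < t] and the digit is at least
    [b - c]. *)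
Lemma floor_digit y t : (0 < b)%N -> b%:R * t <= c%:R -> dist_int y < t ->
  Num.floor (b%:R * y) - b%:Z * Num.floor y \in digits b c.
Proof.
move=> b0 btc /dist_int_ltP[m ymt]; apply: mem_digits.
have b0R : 0 < b%:R :> R by rewrite ltr0n.
have /andP[fy yf] := floor_itv y.
have /andP[fby byf] := floor_itv (b%:R * y).
set n := Num.floor y in fy yf *; set q := Num.floor _ in fby byf *.
rewrite intrD in yf byf; pose f := y - n%:~R.
have bf : b%:R * f = b%:R * y - b%:R * n%:~R by rewrite /f mulrBr.
have bn : (b%:Z * n)%:~R = b%:R * n%:~R :> R by rewrite intrM.
have bf0 : 0 <= b%:R * f by rewrite mulr_ge0 ?ler0n// subr_ge0.
have bf1 : b%:R * f < b%:R by rewrite gtr_pMr// /f; lra.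
have qn0 : 0 <= q - b%:Z * n.
  rewrite -ltzD1 -(ltr_int R) !intrD intrN bn; lra.
have qnb : q - b%:Z * n < b%:Z.
  rewrite -(ltr_int R) intrD intrN bn; lra.
rewrite qn0 qnb andbT /=.
have [mn|nm] := leP m n; apply/orP; [left|right].
  rewrite -(ltr_int R) intrD intrN bn.
  have : b%:R * f < b%:R * t.
    rewrite ltr_pM2l//; move: mn; rewrite -(ler_int R) => mn.
    by have := ler_norm (y - m%:~R); rewrite /f; lra.
  lra.
(* The floor only gives [b * y < q + 1], so the weak integer bound is proved as a strict real bound
   on the digit plus one. *)
rewrite -ltzD1 -(ltr_int R) !intrD !intrN bn.
have : b%:R * (1 - f) < b%:R * t.
  rewrite ltr_pM2l//; move: nm; rewrite -lezD1 -(ler_int R) intrD => nm.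
  by have := ler_norm (m%:~R - y); rewrite distrC /f; lra.
rewrite mulrBr mulr1; lra.
Qed.

(** Induction on [k]: passing from [y = x * b ^ k] to [b * y] appends one digit to the floor,
    admissible because [y] is within [t] of an integer. *)
Lemma floor_cells x t k : (0 < b)%N -> b%:R * t <= c%:R -> 0 <= x < 1 ->
  (forall j, dist_int (x * b%:R ^+ j) < t) ->
  Num.floor (x * b%:R ^+ k) \in cells b c k.
Proof.
move=> b0 btc x01 xt; elim: k => [|k IH].
  rewrite expr0 mulr1 /= inE; apply/eqP/floor_def.
  by rewrite add0r.
set y := x * b%:R ^+ k in IH.
rewrite exprSr mulrA -/y mulrC.
rewrite -[Num.floor _](subrKC (b%:Z * Num.floor y)).
by apply: allpairs_f => //; apply: floor_digit (xt k).
Qed.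

Lemma expr_small (z e : R) : 0 <= z < 1 -> 0 < e ->
  exists n, forall k, (n <= k)%N -> z ^+ k <= e.
Proof.
move=> /andP[z0 z1] e0; have : `|z| < 1 by rewrite ger0_norm.
move=> /cvg_expr/cvgr0_norm_le/(_ _ e0)[n _ zn]; exists n => k nk.
by have := zn k nk; rewrite /= ger0_norm// exprn_ge0.
Qed.

(** At level [k] there are [(2 * c) ^ k] intervals of length [b ^ -k], so the [s]-sum is the [k]-th
    power of a number below 1. *)
Lemma orbit_thin t s : (1 < b)%N -> b%:R * t <= c%:R ->
  (2 * c)%:R * (b%:R^-1 `^ s) < 1 ->
  thin s [set x : R | 0 <= x < 1 /\ forall j, dist_int (x * b%:R ^+ j) < t].
Proof.
move=> b1 btc bs1 e e0.
have b0 : 0 < b%:R :> R by rewrite ltr0n; exact: ltnW.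
have [n1 h1] : exists n, forall k, (n <= k)%N -> b%:R^-1 ^+ k <= e.
  by apply: expr_small => //; rewrite invr_ge0 ltW//= invf_lt1// ltr1n.
have [n2 h2] : exists n, forall k, (n <= k)%N ->
    ((2 * c)%:R * (b%:R^-1 `^ s)) ^+ k <= e.
  by apply: expr_small => //; rewrite bs1 mulr_ge0// powR_ge0.
pose k := maxn n1 n2; pose w : R := b%:R^-1 ^+ k.
exists [seq m%:~R * w | m <- cells b c k], w; split.
- by rewrite exprn_gt0 ?invr_gt0//= h1// leq_maxl.
- rewrite size_map size_cells natrX.
  have -> : w `^ s = (b%:R^-1 `^ s) ^+ k.
    by rewrite /w -(@powR_mulrn _ b%:R^-1) ?invr_ge0 ?ltW// powRAC powR_mulrn ?powR_ge0.
  by rewrite -exprMn h2// leq_maxr.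
move=> x /= [x01 xt]; exists ((Num.floor (x * b%:R ^+ k))%:~R * w).
  apply: (map_f (fun m : int => m%:~R * w)).
  by apply: (floor_cells _ _ btc) => //; exact: ltnW.
have w0 : 0 < w by rewrite exprn_gt0 ?invr_gt0.
have /andP[fx xf] := floor_itv (x * b%:R ^+ k).
(* After this rescaling, membership in the cell is the floor inequality multiplied by [w]. *)
have {2 3}-> : x = x * b%:R ^+ k * w.
  by rewrite /w exprVn mulfK// expf_neq0// gt_eqF.
by rewrite ler_pM2r// fx /= -[X in _ + X]mul1r -mulrDl ler_pM2r// -(intrD R _ 1) ltW.
Qed.

End Cells.

(** * Dimension bound and negligibility of the spectrum *)

Section SpectrumThin.
Context {R : realType} (a : nat) (ha : (2 <= a)%N).
Implicit Types (l : nat) (s t : R).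

Lemma expn_gt1 l : (0 < l)%N -> (1 < a ^ l)%N.
Proof. by move=> l0; rewrite -{1}(exp1n l) ltn_exp2r. Qed.

(** The orbit in base [a ^ l] is the part of the base-[a] orbit at exponents [l * j], so it stays at
    distance at most [x < t] from the integers. *)
Lemma spectrum_thin l t s (c : nat) : (0 < l)%N -> t < 1 / 2 ->
  a%:R ^+ l * t <= c%:R -> (2 * c)%:R * ((a%:R ^+ l)^-1 `^ s) < 1 ->
  thin s (spectrum R a `&` `[0, t[%classic).
Proof.
move=> l0 t2 atc; rewrite -natrX in atc * => cs1 e e0.
have [r [w [we rw Er]]] := orbit_thin (expn_gt1 l0) atc cs1 e0.
exists r, w; split=> // x [sx /=]; rewrite in_itv/= => /andP[x0 xt].
apply: Er; split=> [|j]; first by rewrite x0; lra.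
by rewrite natrX -exprM; apply: le_lt_trans xt; exact: spectrum_orbit_le.
Qed.

Lemma hausdorff_dim_spectrum_le l t : (0 < l)%N -> 0 < t -> t < 1 / 2 ->
  (hausdorff_dim (spectrum R a `&` `[0%R, t[) <=
    (ln ((2 * Num.ceil (a%:R ^+ l * t))%:~R : R) / ln (a%:R ^+ l : R))%:E)%E.
Proof.
move=> l0 t0 t2; set b : R := a%:R ^+ l; pose c := `|Num.ceil (b * t)|%N.
have b1 : 1 < b by rewrite /b -natrX ltr1n expn_gt1.
have b0 : 0 < b by lra.
have bt0 : 0 < b * t by rewrite mulr_gt0.
have cE : c%:Z = Num.ceil (b * t).
  by rewrite /c gez0_abs// ltW// ceil_gt0.
have btc : b * t <= c%:R.
  by have := ceil_ge (b * t); rewrite -cE.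
have c0 : (0 < c)%N by rewrite -(ltr_nat R); lra.
have -> : (2 * Num.ceil (b * t))%:~R = (2 * c)%:R :> R.
  by rewrite -cE natrM intrM.
set N : R := (2 * c)%:R; have N1 : 1 <= N by rewrite ler1n; lia.
have lb0 : 0 < ln b by rewrite ln_gt0.
have lN0 : 0 <= ln N by rewrite ln_ge0.
apply/lee_addgt0Pr => e e0; rewrite -EFinD.
(* Since [N = b ^ (ln N / ln b)], the excess [e] gives [N * b ^ -s = b ^ -e < 1]. *)
set s := _ + e; apply: ereal_inf_lbound; exists s => //.
have s0 : 0 <= s by apply: addr_ge0; [rewrite divr_ge0// ltW|exact: ltW].
split=> //; apply: thin_hausdorff_measure => //.
apply: (spectrum_thin l0 t2 btc); rewrite -/b -/N.
have -> : N * b^-1 `^ s = expR (- (e * ln b)).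
  rewrite /powR gt_eqF ?invr_gt0// lnV ?posrE// -{1}(@lnK _ N) ?posrE; last lra.
  by rewrite -expRD; congr expR; rewrite /s; field; rewrite gt_eqF.
by rewrite expR_lt1 oppr_lt0 mulr_gt0.
Qed.

Lemma spectrum_itv_negligible t : 0 < t -> t < 1 / 2 ->
  (@lebesgue_measure R).-negligible (spectrum R a `&` `[0, t[%classic).
Proof.
move=> t0 t2; have a1 : 1 < a%:R :> R by rewrite ltr1n.
(* The aim is [2 * c < b]. As [c < b * t + 1], it follows from [b * (1 - 2 * t) >= 4]. *)
have [||n an] := @expr_small R a%:R^-1 ((1 - 2 * t) / 4).
- by rewrite invr_ge0 ltW//= ?invf_lt1//; lra.
- by lra.
(* The successor ensures a positive exponent [l]. *)
have {}an := an _ (leqnSn n); set l := n.+1 in an.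
set b : R := a%:R ^+ l; have b0 : 0 < b by rewrite exprn_gt0//; lra.
pose c := `|Num.ceil (b * t)|%N.
have bt0 : 0 < b * t by rewrite mulr_gt0.
have cE : c%:Z = Num.ceil (b * t).
  by rewrite /c gez0_abs// ltW// ceil_gt0.
have := ceil_itv (b * t); rewrite -cE intrD => /andP[ct tc].
apply: thin_negligible; apply: (@spectrum_thin l t 1 c) => //.
rewrite powRr1 ?invr_ge0 ?ltW// -/b ltr_pdivrMr// mul1r natrM.
have : 1 <= (1 - 2 * t) / 4 * b by rewrite -ler_pdivrMr// mul1r /b -exprVn.
lra.
Qed.

Lemma spectrum_negligible : (@lebesgue_measure R).-negligible (spectrum R a).
Proof.
(* The spectrum lies in [[0, 1/2]], which is exhausted by the intervals [[0, t n[] and the point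
   [1/2]; the shift by 3 keeps [t n] positive. *)
pose t n : R := 1 / 2 - n.+3%:R^-1.
have t0 n : 0 < t n.
  by rewrite subr_gt0 mul1r ltf_pV2 ?posrE// ltr_nat.
have t2 n : t n < 1 / 2 by rewrite gtrBl invr_gt0.
have : (@lebesgue_measure R).-negligible ([set 1 / 2] `|`
    \bigcup_n (spectrum R a `&` `[0, t n[%classic)).
  apply: negligibleU; last first.
    by apply: negligible_bigcup => n; exact: spectrum_itv_negligible.
  by apply/negligibleP => //; exact: lebesgue_measure_set1.
apply: negligibleS.
move=> x sx; have := spectrum_le_half sx; rewrite le_eqVlt => /predU1P[->|x2].
  by left.
right; have d0 : 0 < 1 / 2 - x by lra.
have [n _ /(_ n (leqnn n)) /= nx] := near_infty_natSinv_lt (PosNum d0).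
exists n => //; split=> //=.
rewrite in_itv/= (spectrum_ge0 sx)/= /t ltrBrDr -ltrBrDl.
apply: le_lt_trans nx.
by rewrite lef_pV2 ?posrE// ler_nat; lia.
Qed.

End SpectrumThin.

Theorem theorem2p2 (R : realType) (a : nat) (ha : (2 <= a)%N) :
  (forall (l : nat) (t : R), (1 <= l)%N -> 0 < t -> t < 1 / 2 ->
     (hausdorff_dim (spectrum R a `&` `[0%R, t[) <=
       (ln ((2 * Num.ceil (a%:R ^+ l * t))%:~R : R) / ln (a%:R ^+ l : R))%:E)%E)
  /\ (@lebesgue_measure R).-negligible (spectrum R a).
Proof.
split; last exact: spectrum_negligible.
by move=> l t; exact: hausdorff_dim_spectrum_le.
Qed.
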